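(* Let $\mathbb{T}$ be a time scale, let $a,b\in\mathbb{T}$ with $a<b$, let $[a,b]$ denote the interval $\{t\in\mathbb{T}: a\le t\le b\}$ in $\mathbb{T}$, and let $0\le\alpha\le 1$. Let $f,g:[a,b]\rightarrow\mathbb{R}$ be continuous functions. Then $$\int_a^b |f(t)g(t)|\,\Diamond_\alpha t \leq \sqrt{\left[\int_a^b |f(t)|^2\,\Diamond_\alpha t\right]\left[\int_a^b |g(t)|^2\,\Diamond_\alpha t\right]}.$$
   Context: A time scale $\mathbb{T}$ is a nonempty closed subset of $\mathbb{R}$, with the topology induced from $\mathbb{R}$. The forward and backward jump operators $\sigma,\rho:\mathbb{T}\to\mathbb{T}$ are $\sigma(t)=\inf\{s\in\mathbb{T}: s>t\}$ and $\rho(t)=\sup\{s\in\mathbb{T}: s<t\}$, with the conventions $\inf\emptyset=\sup\mathbb{T}$ and $\sup\emptyset=\inf\mathbb{T}$. For $a<b$ in $\mathbb{T}$, $[a,b]$ denotes $\{t\in\mathbb{T}: a\le t\le b\}$. A function $F:[a,b]\to\mathbb{R}$ has delta derivative $F^\Delta(t)$ at $t\in[a,b]$, $t<b$, if for every $\varepsilon>0$ there is a neighborhood $U$ of $t$ in $[a,b]$ with $|F(\sigma(t))-F(s)-F^\Delta(t)(\sigma(t)-s)|\le\varepsilon|\sigma(t)-s|$ for all $s\in U$. It has nabla derivative $F^\nabla(t)$ at $t\in[a,b]$, $t>a$, if for every $\varepsilon>0$ there is a neighborhood $U$ of $t$ in $[a,b]$ with $|F(\rho(t))-F(s)-F^\nabla(t)(\rho(t)-s)|\le\varepsilon|\rho(t)-s|$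 for all $s\in U$. For continuous $f:[a,b]\to\mathbb{R}$, the delta integral is $\int_a^b f(t)\,\Delta t=F(b)-F(a)$, where $F$ is a delta antiderivative of $f$ (a continuous $F:[a,b]\to\mathbb{R}$ with $F^\Delta(t)=f(t)$ for all $t\in[a,b]$, $t<b$); the nabla integral is $\int_a^b f(t)\,\nabla t=G(b)-G(a)$, where $G$ is a nabla antiderivative of $f$ (a continuous $G:[a,b]\to\mathbb{R}$ with $G^\nabla(t)=f(t)$ for all $t\in[a,b]$, $t>a$). Both integrals exist and are well defined for continuous $f$. For $0\le\alpha\le1$, the diamond-$\alpha$ integral is $$\int_a^b f(t)\,\Diamond_\alpha t=\alpha\int_a^b f(t)\,\Delta t+(1-\alpha)\int_a^b f(t)\,\nabla t.$$ *)

(* Defs.v *)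
From HB Require Import structures.
From mathcomp Require Import all_boot all_order all_algebra.
From mathcomp Require Import all_classical all_reals all_analysis.

Set Implicit Arguments.
Unset Strict Implicit.
Unset Printing Implicit Defensive.

Import Order.TTheory GRing.Theory Num.Theory.
Import numFieldNormedType.Exports.

Local Open Scope classical_set_scope.
Local Open Scope ring_scope.

(* Functions on the time-scale interval [a, b] are represented by total
   functions R -> R; nothing below depends on their values outside it. *)

Definition time_scale (R : realType) (T : set R) : Prop :=
  T !=set0 /\ closed T.

Definition ts_itv (R : realType) (T : set R) (a b : R) : set R :=
  [set t | T t /\ a <= t <= b].

(* The library's [inf set0] and [sup set0] are 0, so the conventions
   inf set0 = sup T and sup set0 = inf T are spelled out. For t in T the
   empty case occurs only when t is the maximum (resp. minimum) of T, so the
   [sup T] (resp. [inf T]) used is then a genuine one. *)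
Definition sigma (R : realType) (T : set R) (t : R) : R :=
  if [set s | T s /\ t < s] == set0 then sup T
  else inf [set s | T s /\ t < s].

Definition rho (R : realType) (T : set R) (t : R) : R :=
  if [set s | T s /\ s < t] == set0 then inf T
  else sup [set s | T s /\ s < t].

Definition is_delta_derive (R : realType) (T : set R) (a b : R)
    (F : R -> R) (t d : R) : Prop :=
  forall eps : R, 0 < eps ->
    \forall s \near within (ts_itv T a b) (nbhs t),
      `|F (sigma T t) - F s - d * (sigma T t - s)| <= eps * `|sigma T t - s|.

Definition is_nabla_derive (R : realType) (T : set R) (a b : R)
    (F : R -> R) (t d : R) : Prop :=
  forall eps : R, 0 < eps ->
    \forall s \near within (ts_itv T a b) (nbhs t),
      `|F (rho T t) - F s - d * (rho T t - s)| <= eps * `|rho T t - s|.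

Definition delta_antiderivative (R : realType) (T : set R) (a b : R)
    (f F : R -> R) : Prop :=
  {within ts_itv T a b, continuous F} /\
  forall t, ts_itv T a b t -> t < b -> is_delta_derive T a b F t (f t).

Definition nabla_antiderivative (R : realType) (T : set R) (a b : R)
    (f G : R -> R) : Prop :=
  {within ts_itv T a b, continuous G} /\
  forall t, ts_itv T a b t -> a < t -> is_nabla_derive T a b G t (f t).

(* [xget] picks some antiderivative; the zero function is a placeholder for
   integrands that have none (this never happens for continuous f). *)
Definition delta_integral (R : realType) (T : set R) (a b : R)
    (f : R -> R) : R :=
  let F := xget (fun _ : R => 0 : R) (delta_antiderivative T a b f) in
  F b - F a.

Definition nabla_integral (R : realType) (T : set R) (a b : R)
    (f : R -> R) : R :=
  let G := xget (fun _ : R => 0 : R) (nabla_antiderivative T a b f) in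
  G b - G a.

Definition diamond_integral (R : realType) (T : set R) (alpha a b : R)
    (f : R -> R) : R :=
  alpha * delta_integral T a b f + (1 - alpha) * nabla_integral T a b f.

(* Main.v *)
Require Import Defs.
From HB Require Import structures.
From mathcomp Require Import all_boot all_order all_algebra.
From mathcomp Require Import all_classical all_reals all_analysis.
From mathcomp Require Import measurable_realfun ring lra.

Set Implicit Arguments.
Unset Strict Implicit.
Unset Printing Implicit Defensive.

Import Order.TTheory GRing.Theory Num.Theory.
Import numFieldNormedType.Exports.

Local Open Scope classical_set_scope.
Local Open Scope ring_scope.

(** The diamond integral is a positive linear functional on continuous
    functions, so the integral of [(x |f| - |g|)^2] is a quadratic polynomial
    in [x] that is nonnegative everywhere, and its discriminant gives the
    inequality. Positivity of the delta integral: the supremum of the points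
    up to which [F s - F a >= - e * (s - a)] cannot lie below [b]. Existence of
    delta antiderivatives: if [q u] is the supremum of the points of [T] before
    [u], then [f (q u)] is constant on every gap [t < u <= sigma t] with value
    [f t], so its Lebesgue primitive is a delta antiderivative of [f].
    Reflecting the time scale exchanges delta and nabla. *)

(** * Neighbourhoods and continuity relative to a subset of the line *)

Lemma near_withinP (R : realType) (A P : set R) (t : R) :
  (\forall s \near within A (nbhs t), P s) <->
  exists2 d : R, 0 < d & forall s, A s -> `|t - s| < d -> P s.
Proof.
split.
  by move=> /nbhs_ballP[d /= d0 dP]; exists d => // s As ts; exact: dP.
by move=> [d d0 dP]; apply/nbhs_ballP; exists d => // s ts As; exact: dP.
Qed.

Lemma within_continuousP (R : realType) (A : set R) (f : R -> R) :
  {within A, continuous f} <->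
  forall t, A t -> forall e : R, 0 < e ->
    \forall s \near within A (nbhs t), `|f t - f s| <= e.
Proof.
split => [/subspace_continuousP cf t At e e0|cf].
  by move/cvgrPdist_le: (cf t At); exact.
by apply/subspace_continuousP => t At; apply/cvgrPdist_le => e e0; exact: cf.
Qed.

Lemma ts_itv_closed (R : realType) (T : set R) (a b : R) :
  closed T -> closed (ts_itv T a b).
Proof.
move=> cT; have -> : ts_itv T a b = T `&` [set` `[a, b]].
  by apply/seteqP; split => t; rewrite /ts_itv /= in_itv.
by apply: closedI => //; exact: interval_closed.
Qed.

(** * The forward jump operator *)

Lemma ge_sigma (R : realType) (T : set R) (t s : R) :
  T s -> t < s -> sigma T t <= s.
Proof.
(* The point [s] rules out the empty case, so [sigma T t] is a genuine infimum here. *)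
move=> Ts ts; rewrite /sigma ifF; last first.
  by apply/negP => /eqP/seteqP[/(_ s (conj Ts ts))].
by apply: ge_inf => //; exists t => u [_ /ltW].
Qed.

Lemma le_sigma (R : realType) (T : set R) (t s : R) :
  T s -> t < s -> t <= sigma T t.
Proof.
move=> Ts ts; rewrite /sigma ifF; last first.
  by apply/negP => /eqP/seteqP[/(_ s (conj Ts ts))].
by apply: lb_le_inf; [exists s|move=> u [_ /ltW]].
Qed.

Lemma sigma_adherent (R : realType) (T : set R) (t s e : R) :
  T s -> t < s -> 0 < e -> exists2 u, T u /\ t < u & u < sigma T t + e.
Proof.
move=> Ts ts e0; rewrite /sigma ifF; last first.
  by apply/negP => /eqP/seteqP[/(_ s (conj Ts ts))].
by apply: inf_adherent => //; split; [exists s|exists t => u [_ /ltW]].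
Qed.

Lemma closed_sigma (R : realType) (T : set R) (t s : R) :
  closed T -> T s -> t < s -> T (sigma T t).
Proof.
move=> cT Ts ts; suff : closure T (sigma T t) by move/closure_id: cT => <-.
move=> V /nbhs_ballP[e /= e0 eV].
have [u [Tu tu] ue] := sigma_adherent Ts ts e0.
exists u; split => //; apply: eV; rewrite /ball /= distrC.
by rewrite ger0_norm ?subr_ge0 ?ge_sigma// ltrBlDl.
Qed.

(** * Positivity of the delta integral *)

Lemma delta_antiderivative_le (R : realType) (T : set R) (a b : R)
    (f F : R -> R) : closed T -> T a -> T b -> a < b ->
  (forall t, ts_itv T a b t -> 0 <= f t) ->
  delta_antiderivative T a b f F -> F a <= F b.
Proof.
move=> cT Ta Tb ab f0 [/within_continuousP cF dF].
set K := ts_itv T a b.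
have Ka : K a by rewrite /K /ts_itv /= lexx ltW.
have Kb : K b by rewrite /K /ts_itv /= lexx ltW.
(* The slack [e] absorbs the error term of the delta derivative. It is removed at the end by using
   [e / (b - a)], which makes the total loss over [[a, b]] equal to [e]. *)
suff H (e : R) : 0 < e -> - e * (b - a) <= F b - F a.
  rewrite -subr_ge0; apply/ler_addgt0Pl => e e0.
  have ba0 : 0 < b - a by rewrite subr_gt0.
  have := H (e / (b - a)) (divr_gt0 e0 ba0).
  by rewrite mulNr divfK ?gt_eqF// -subr_ge0 opprK addrC.
move=> e0.
pose good s := - e * (s - a) <= F s - F a.
pose S := [set t | K t /\ forall s, K s -> s <= t -> good s].
have Sa : S a.
  split=> // s [_ /andP[sa _]] sa'; have -> : s = a by apply/le_anti; rewrite sa'.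
  by rewrite /good !subrr mulr0.
have uS : has_ubound S by exists b => t [[_ /andP[]]].
have supS : has_sup S by split => //; exists a.
set c := sup S.
have Kc : K c.
  have cK : closed K := ts_itv_closed cT.
  suff : closure K c by move/closure_id: cK => <-.
  by apply: (@closureS _ S) => [t []//|]; apply: closure_sup => //; exists a.
have below s : K s -> s < c -> good s.
  move=> Ks sc; have c_s : 0 < c - s by rewrite subr_gt0.
  have [u [_ Su]] := sup_adherent c_s supS.
  by rewrite opprB addrC subrK => /ltW su; exact: Su.
have goodc : good c.
  rewrite /good leNgt; apply/negP => bad.
  (* [eta] is half the deficit of [F c]. By continuity [F] deviates from [F c] by at most [eta] near
     [c], so points of [S] close to [c] would still have a deficit. *)
  set eta := (- e * (c - a) - (F c - F a)) / 2.
  have eta0 : 0 < eta by rewrite divr_gt0// subr_gt0.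
  have /near_withinP[d d0 Hd] := cF c Kc eta eta0.
  have [u Su cu] := sup_adherent d0 supS.
  have uc : u <= c by exact: ub_le_sup.
  have uc' : 0 <= c - u by rewrite subr_ge0.
  have := Hd u Su.1; rewrite ger0_norm ?subr_ge0// ltrBlDr -ltrBlDl => /(_ _).
  have -> : c - d < u by [].
  move=> /(_ isT); rewrite ler_norml => /andP[+ _].
  have := Su.2 u Su.1 (lexx _); rewrite /good /eta.
  have := mulr_ge0 (ltW e0) uc'; nra.
have [cb|bc] := ltP c b; last first.
  have /andP[_ cb] := Kc.2.
  by have -> : b = c by apply/le_anti; rewrite bc.
(* Adding a bound relative to [c] to [goodc] would put [u] in [S], above its supremum. *)
suff [u [Ku cu Hu]] : exists u, [/\ K u, c < u &
    forall s, K s -> c < s -> s <= u -> - e * (s - c) <= F s - F c].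
  have : S u.
    split => // s Ks su; have [sc|cs|->//] := ltgtP s c; first exact: below.
    by move: (Hu s Ks cs su) goodc; rewrite /good; nra.
  by move/(ub_le_sup uS); rewrite leNgt cu.
have fc := f0 c Kc.
have [Tc /andP[ac _]] := Kc.
have := le_sigma Tb cb; rewrite le_eqVlt => /predU1P[cE|csig].
  (* Right-dense case: points of [T] accumulate at [c] from the right. Any such [u] within the
     radius [d] works, and the minimum with [b - c] keeps it in [[a, b]]. *)
  have /near_withinP[d d0 Hd] := dF c Kc cb e e0.
  have dd : 0 < Num.min d (b - c) by rewrite lt_min d0 subr_gt0.
  have [u [Tu cu]] := sigma_adherent Tb cb dd.
  rewrite -cE -ltrBlDl lt_min => /andP[ud ub].
  have {}ub : u <= b by rewrite ltW// -(ltrD2r (- c)).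
  exists u; split => //; first by split => //; rewrite ub andbT (le_trans ac)// ltW.
  move=> s Ks cs su; have := Hd s Ks.
  rewrite -cE distrC gtr0_norm ?subr_gt0//.
  move=> /(_ (le_lt_trans (lerB su (lexx c)) ud)).
  by rewrite ler_norml => /andP[_]; nra.
(* Right-scattered case: [sigma T c] is the only point of [T] to check. The derivative estimate is
   read at [c] itself, which lies in each of its neighbourhoods. *)
exists (sigma T c); split => //.
  split; first exact: closed_sigma Tb cb.
  by rewrite ge_sigma// andbT (le_trans ac)// ltW.
move=> s [Ts _] cs sm.
have -> : s = sigma T c by apply/le_anti; rewrite sm ge_sigma.
have /near_withinP[d d0 Hd] := dF c Kc cb e e0.
have := Hd c Kc; rewrite subrr normr0 => /(_ d0).
rewrite [X in _ <= _ * X]gtr0_norm ?subr_gt0// ler_norml => /andP[+ _]; nra.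
Qed.

(** * Existence of delta antiderivatives *)

(** The left side is the absolute value of the Lebesgue integral of [h - c] over []x, y]]. The
    half-open interval matches the gaps []t, sigma t]]. The same estimate gives the Lipschitz bound
    ([c = 0]) and the delta derivative ([c = f t]). *)
Lemma bounded_primitive (R : realType) (a b : R) (h : R -> R) :
  measurable_fun `[a, b] h -> [bounded h x | x in `[a, b]] ->
  exists H : R -> R, forall x y c e : R, a <= x -> x <= y -> y <= b ->
    (forall u, x < u -> u <= y -> `|h u - c| <= e) ->
    `|H y - H x - c * (y - x)| <= e * (y - x).
Proof.
move=> mh bh.
have ih : (@lebesgue_measure R).-integrable `[a, b] (EFin \o h).
  apply: measurable_bounded_integrable => //=.
  by rewrite lebesgue_measure_itv /=; case: ifP => _ //; rewrite -EFinD ltry.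
exists (fun x => \int[@lebesgue_measure R]_(u in `[a, x]) h u)%R.
move=> x y c e ax xy yb hc.
have iS (i : interval R) : (i <= `[a, b])%O ->
    (@lebesgue_measure R).-integrable [set` i] (EFin \o h).
  by move=> iab; apply: integrableS ih => //; move=> z; exact: subitvP.
have lx : fine (@lebesgue_measure R `]x, y]) = y - x.
  rewrite lebesgue_measure_itv /= lte_fin; move: xy.
  by rewrite le_eqVlt => /predU1P[->|->//]; rewrite ltxx subrr.
have cint (k : R) : (@lebesgue_measure R).-integrable `]x, y] (EFin \o cst k).
  apply: measurable_bounded_integrable => //=.
    by rewrite lebesgue_measure_itv /=; case: ifP => _ //; rewrite -EFinD ltry.
  by exists `|k|; split => // M kM z _ /=; exact: ltW.
have ixy : (@lebesgue_measure R).-integrable `]x, y] (EFin \o h).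
  by apply: iS; rewrite subitvE; apply/andP; split; rewrite bnd_simp.
rewrite Rintegral_itvB ?bnd_simp //; last first.
  by apply: iS; rewrite subitvE; apply/andP; split; rewrite bnd_simp.
have Icst (k : R) : k * (y - x) = \int[@lebesgue_measure R]_(u in `]x, y]) k.
  by rewrite Rintegral_cst // lx.
rewrite !Icst -RintegralB //; last exact: cint.
have ihc : (@lebesgue_measure R).-integrable `]x, y]
    (EFin \o (fun u => h u - cst c u)).
  by apply: eq_integrable (integrableB _ ixy (cint c)) => //= u _; rewrite EFinB.
apply: le_trans (le_normr_Rintegral _ ihc) _ => //.
apply: le_Rintegral => //.
- exact: integrable_norm ihc.
- exact: cint.
by move=> u /=; rewrite in_itv /= => /andP[xu uy]; exact: hc.
Qed.

(* The disjunct [v = a] keeps the set nonempty for every [u], which makes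
   [ts_left] monotone on the whole real line. *)
Definition ts_left (R : realType) (T : set R) (a b u : R) : R :=
  sup [set v | ts_itv T a b v /\ (v < u \/ v = a)].

Lemma ts_left_has_sup (R : realType) (T : set R) (a b u : R) :
  T a -> a <= b -> has_sup [set v | ts_itv T a b v /\ (v < u \/ v = a)].
Proof.
move=> Ta ab; split; first by exists a; split; [split; rewrite ?lexx|right].
by exists b => v [[_ /andP[]]].
Qed.

Lemma ts_left_itv (R : realType) (T : set R) (a b u : R) :
  closed T -> T a -> a <= b -> ts_itv T a b (ts_left T a b u).
Proof.
move=> cT Ta ab; have [? ?] := ts_left_has_sup u Ta ab.
have cK : closed (ts_itv T a b) := ts_itv_closed cT.
suff : closure (ts_itv T a b) (ts_left T a b u) by move/closure_id: cK => <-.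
by apply: (closureS _ (closure_sup _ _)) => // v [].
Qed.

Lemma le_ts_left (R : realType) (T : set R) (a b u v : R) :
  T a -> a <= b -> ts_itv T a b v -> v < u -> v <= ts_left T a b u.
Proof.
move=> Ta ab Kv vu; have [_ ?] := ts_left_has_sup u Ta ab.
by apply: ub_le_sup => //; split => //; left.
Qed.

Lemma ge_ts_left (R : realType) (T : set R) (a b u w : R) :
  T a -> a <= b -> a <= w ->
  (forall v, ts_itv T a b v -> v < u -> v <= w) -> ts_left T a b u <= w.
Proof.
move=> Ta ab aw uw; have [? _] := ts_left_has_sup u Ta ab.
by apply: ge_sup => // v [Kv [/(uw _ Kv)//|->]].
Qed.

Lemma ts_left_nondecreasing (R : realType) (T : set R) (a b : R) :
  T a -> a <= b -> {homo ts_left T a b : u v / u <= v}.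
Proof.
move=> Ta ab u v uv; have [_ ubv] := ts_left_has_sup v Ta ab.
apply: ge_ts_left => // [|w Kw wu].
  by apply: ub_le_sup => //; split; [split; rewrite ?lexx|right].
by apply: le_ts_left => //; exact: lt_le_trans uv.
Qed.

Lemma continuous_ts_itv_bounded (R : realType) (T : set R) (a b : R)
    (f : R -> R) : closed T -> {within ts_itv T a b, continuous f} ->
  exists M : R, forall t, ts_itv T a b t -> `|f t| <= M.
Proof.
move=> cT cf.
have cK : compact (ts_itv T a b).
  apply: (@subclosed_compact _ _ `[a, b]); first exact: ts_itv_closed.
    exact: segment_compact.
  by move=> t [_ tab]; rewrite /= in_itv.
have /compact_bounded[M [_ HM]] := continuous_compact cf cK.
by exists (M + 1) => t Kt; apply: (HM (M + 1)); [rewrite ltrDl|exists t].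
Qed.

Lemma delta_antiderivative_exists (R : realType) (T : set R) (a b : R)
    (f : R -> R) : closed T -> T a -> T b -> a < b ->
  {within ts_itv T a b, continuous f} ->
  exists F, delta_antiderivative T a b f F.
Proof.
move=> cT Ta Tb ab cf; have leab := ltW ab.
have [M fM] := continuous_ts_itv_bounded cT cf.
have fqM u : `|f (ts_left T a b u)| <= M by apply: fM; exact: ts_left_itv.
have [||H HP] := @bounded_primitive R a b (f \o ts_left T a b).
(* [ts_left] is monotone, hence measurable, and takes values in the closed set where [f] is
   continuous. *)
- apply: (@measurable_comp _ _ _ _ _ _ (ts_itv T a b)).
  + by apply: closed_measurable; exact: ts_itv_closed.
  + by move=> _ [u _ <-]; exact: ts_left_itv.
  + apply: subspace_continuous_measurable_fun => //.
    by apply: closed_measurable; exact: ts_itv_closed.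
  + by apply: nondecreasing_measurable => //; exact: ts_left_nondecreasing.
- exists M; split=> [|N MN]; first exact: num_real.
  move=> u _ /=; exact: le_trans (ltW MN).
have lipH x y : a <= x -> x <= y -> y <= b -> `|H y - H x| <= M * (y - x).
  move=> ax xy yb; have := HP x y 0 M ax xy yb; rewrite mul0r subr0; apply.
  by move=> u _ _; rewrite subr0; exact: fqM.
have M0 : 0 <= M by exact: le_trans (fqM a).
exists H; split.
  apply/within_continuousP => t [_ /andP[at_ tb]] e e0.
  (* [M + 1] replaces the Lipschitz constant [M], which may be 0. *)
  apply/near_withinP; exists (e / (M + 1)); first by rewrite divr_gt0// ltr_wpDl.
  move=> s [_ /andP[as_ sb]]; rewrite ltr_pdivlMr ?ltr_wpDl// => tse.
  apply: le_trans (ltW tse); rewrite mulrC mulrDl mul1r ler_wpDr//.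
  have [ts|st] := leP t s.
    by rewrite distrC (distrC t s) [X in _ <= _ * X]ger0_norm ?subr_ge0//; exact: lipH.
  by rewrite [X in _ <= _ * X]gtr0_norm ?subr_gt0//; apply: lipH => //; exact: ltW.
move=> t Kt tb e e0; have [Tt /andP[at_ _]] := Kt.
have /near_withinP[d d0 Hd] := (within_continuousP _ _).1 cf t Kt e e0.
have sigb : sigma T t <= b by exact: ge_sigma.
have tsig : t <= sigma T t by exact: le_sigma tb.
apply/near_withinP; exists d => // s [Ts /andP[as_ sb]] tsd.
(* For [s <= t], no point of [T] lies strictly between [t] and [sigma T t]. Hence [ts_left] maps
   []s, sigma T t]] into [[s, t]], where [f] is within [e] of [f t]. *)
have [st|ts] := leP s t.
  have ssig := le_trans st tsig.
  rewrite [X in _ <= _ * X]ger0_norm ?subr_ge0//; apply: HP => // u su usig.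
  rewrite /= distrC; apply: Hd; first exact: ts_left_itv.
  apply: le_lt_trans tsd.
  have q1 : s <= ts_left T a b u by apply: le_ts_left => //; rewrite /ts_itv /= as_.
  have q2 : ts_left T a b u <= t.
    apply: ge_ts_left => // v [Tv _] vu; rewrite leNgt; apply/negP => tv.
    by have := lt_le_trans vu usig; rewrite ltNge ge_sigma.
  by rewrite !ger0_norm ?subr_ge0//; lra.
(* For [s > t] the increment runs from [sigma T t] up to [s], and [ts_left] maps []sigma T t, s]]
   into [[t, s]]. *)
have sigs : sigma T t <= s by exact: ge_sigma.
rewrite -normrN (distrC _ s) [X in _ <= _ * X]ger0_norm ?subr_ge0//.
have -> : - (H (sigma T t) - H s - f t * (sigma T t - s)) =
    H s - H (sigma T t) - f t * (s - sigma T t) by lra.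
have asig := le_trans at_ tsig.
apply: HP => // u sigu us.
rewrite /= distrC; apply: Hd; first exact: ts_left_itv.
apply: le_lt_trans tsd.
have q1 : t <= ts_left T a b u by apply: le_ts_left => //; exact: le_lt_trans sigu.
have q2 : ts_left T a b u <= s.
  by apply: ge_ts_left => // v _ /ltW vu; exact: le_trans us.
by rewrite !(distrC t) !ger0_norm ?subr_ge0 ?(ltW ts)//; lra.
Qed.

(** * Linearity of delta antiderivatives *)

Lemma delta_antiderivativeZD (R : realType) (T : set R) (a b k : R)
    (f g F G : R -> R) :
  delta_antiderivative T a b f F -> delta_antiderivative T a b g G ->
  delta_antiderivative T a b (fun t => k * f t + g t) (fun t => k * F t + G t).
Proof.
move=> [cF dF] [cG dG]; split.
  apply/subspace_continuousP => t Kt; apply: cvgD.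
    by apply: cvgMr; move/subspace_continuousP: cF; exact.
  by move/subspace_continuousP: cG; exact.
move=> t Kt tb e e0.
(* Half of the tolerance goes to each function. Dividing by [|k| + 1] compensates the factor [k] and
   stays meaningful for [k = 0]. *)
have k0 : 0 < `|k| + 1 by rewrite ltr_wpDl.
have e1 : 0 < e / (`|k| + 1) / 2 by rewrite !divr_gt0.
have e2 : 0 < e / 2 by rewrite divr_gt0.
have hF := dF t Kt tb _ e1; have hG := dG t Kt tb _ e2.
near=> s.
have hFs : `|F (sigma T t) - F s - f t * (sigma T t - s)| <=
  e / (`|k| + 1) / 2 * `|sigma T t - s| by near: s.
have hGs : `|G (sigma T t) - G s - g t * (sigma T t - s)| <=
  e / 2 * `|sigma T t - s| by near: s.
set m := `|sigma T t - s| in hFs hGs *.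
have -> : k * F (sigma T t) + G (sigma T t) - (k * F s + G s) -
    (k * f t + g t) * (sigma T t - s) =
    k * (F (sigma T t) - F s - f t * (sigma T t - s)) +
    (G (sigma T t) - G s - g t * (sigma T t - s)) by ring.
apply: le_trans (ler_normD _ _) _; rewrite normrM.
have -> : e * m = (`|k| + 1) * (e / (`|k| + 1) / 2 * m) + e / 2 * m.
  by field; rewrite gt_eqF.
apply: lerD => //; apply: ler_pM => //.
by rewrite lerDl.
Unshelve. all: by end_near. Qed.

(** * Reflection of a time scale *)

Definition ts_opp (R : realType) (T : set R) : set R := [set t | T (- t)].

Lemma ts_opp_closed (R : realType) (T : set R) : closed T -> closed (ts_opp T).
Proof.
by move=> cT; apply: (closed_comp _ cT) => t _; exact: opp_continuous.
Qed.

Lemma ts_itv_opp (R : realType) (T : set R) (a b t : R) :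
  ts_itv (ts_opp T) (- b) (- a) (- t) <-> ts_itv T a b t.
Proof. by rewrite /ts_itv /ts_opp /= opprK !lerN2 andbC. Qed.

Lemma image_oppr (R : realType) (T : set R) : -%R @` T = ts_opp T.
Proof.
apply/seteqP; split => [_ [s Ts <-]|s Ts]; first by rewrite /ts_opp /= opprK.
by exists (- s); rewrite // opprK.
Qed.

Lemma sigma_opp (R : realType) (T : set R) (t : R) :
  sigma (ts_opp T) (- t) = - rho T t.
Proof.
rewrite /sigma /rho.
have E : -%R @` [set s | ts_opp T s /\ - t < s] = [set s | T s /\ s < t].
  rewrite image_oppr; apply/seteqP; rewrite /ts_opp /=.
  by split => s /= [+ st]; rewrite opprK => Ts; split => //; rewrite ltrN2 in st *.
have -> : ([set s | ts_opp T s /\ - t < s] == set0) =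
    ([set s | T s /\ s < t] == set0).
  by rewrite -E; apply/eqP/eqP => [->|/image_set0_set0//]; rewrite image_set0.
(* [inf] unfolds to minus the supremum of the reflected set. This settles the generic case through
   [E], and the empty case by matching the conventions [sup T] and [inf T]. *)
case: ifP => _; last by rewrite /inf E.
by rewrite /inf opprK image_oppr.
Qed.

Lemma near_within_opp (R : realType) (T P : set R) (a b t : R) :
  (\forall s \near within (ts_itv (ts_opp T) (- b) (- a)) (nbhs (- t)), P s) <->
  (\forall s \near within (ts_itv T a b) (nbhs t), P (- s)).
Proof.
split => /near_withinP[d d0 dP]; apply/near_withinP; exists d => // s Ks sd.
  apply: dP; first exact/ts_itv_opp.
  by rewrite -opprD normrN.
rewrite -[s]opprK; apply: dP; first by apply/ts_itv_opp; rewrite opprK.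
by rewrite -normrN opprD opprK.
Qed.

Lemma within_continuous_opp (R : realType) (T : set R) (a b : R) (f : R -> R) :
  {within ts_itv (ts_opp T) (- b) (- a), continuous (fun t => f (- t))} <->
  {within ts_itv T a b, continuous f}.
Proof.
split => /within_continuousP cf; apply/within_continuousP => t Kt e e0.
  have /near_within_opp /= := cf (- t) ((ts_itv_opp _ _ _ _).2 Kt) e e0.
  by under eq_near do rewrite !opprK.
rewrite -[t]opprK; apply/near_within_opp => /=; under eq_near do rewrite !opprK.
by apply: cf => //; apply/ts_itv_opp; rewrite opprK.
Qed.

(** Reflecting the argument flips the sign of the derivative, and the outer minus restores it, so
    the integrand is only reflected. Excluding [b] for delta turns into excluding [a] for nabla. *)
Lemma nabla_antiderivative_opp (R : realType) (T : set R) (a b : R)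
    (f G : R -> R) :
  nabla_antiderivative T a b f G <->
  delta_antiderivative (ts_opp T) (- b) (- a)
    (fun t => f (- t)) (fun t => - G (- t)).
Proof.
have cE : {within ts_itv (ts_opp T) (- b) (- a), continuous (fun t => - G (- t))}
    <-> {within ts_itv T a b, continuous G}.
  rewrite -within_continuous_opp; split => /within_continuousP cG;
  apply/within_continuousP => t Kt e e0; have := cG t Kt e e0.
    by under eq_near do rewrite -opprD normrN.
  by under [X in _ -> X]eq_near do rewrite -opprD normrN.
have dE t : is_delta_derive (ts_opp T) (- b) (- a) (fun t => - G (- t)) (- t)
    (f t) <-> is_nabla_derive T a b G t (f t).
  rewrite /is_delta_derive /is_nabla_derive sigma_opp.
  (* The reflected error term is the opposite of the original one. *)
  have nE e s : (`|- G (- - rho T t) - - G (- - s) - f t * (- rho T t - - s)| <=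
      e * `|- rho T t - - s|) =
      (`|G (rho T t) - G s - f t * (rho T t - s)| <= e * `|rho T t - s|).
    rewrite !opprK -(normrN (- rho T t + s)) opprD opprK; congr (_ <= _).
    by rewrite -normrN; congr `|_|; ring.
  split => H e e0.
    by have /near_within_opp /= := H e e0; under eq_near do rewrite nE.
  by apply/near_within_opp => /=; under eq_near do rewrite nE; exact: H.
split=> -[/cE cG dG]; split => // t Kt tab.
  have := (dE (- t)).2; rewrite opprK; apply; apply: dG.
    by apply/ts_itv_opp; rewrite opprK.
  by rewrite ltrNr.
apply/dE; have := dG (- t) ((ts_itv_opp _ _ _ _).2 Kt).
by rewrite /= ltrN2 opprK; exact.
Qed.

(** * Nabla counterparts obtained by reflection *)

Lemma nabla_antiderivative_exists (R : realType) (T : set R) (a b : R)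
    (f : R -> R) : closed T -> T a -> T b -> a < b ->
  {within ts_itv T a b, continuous f} ->
  exists G, nabla_antiderivative T a b f G.
Proof.
move=> cT Ta Tb ab /within_continuous_opp cf.
have [||||F dF] := delta_antiderivative_exists _ _ _ _ cf.
- exact: ts_opp_closed.
- by rewrite /ts_opp /= opprK.
- by rewrite /ts_opp /= opprK.
- by rewrite ltrN2.
exists (fun t => - F (- t)); apply/nabla_antiderivative_opp.
by rewrite (_ : (fun t => - - _) = F)//; apply/funext => t; rewrite !opprK.
Qed.

Lemma nabla_antiderivative_le (R : realType) (T : set R) (a b : R)
    (f G : R -> R) : closed T -> T a -> T b -> a < b ->
  (forall t, ts_itv T a b t -> 0 <= f t) ->
  nabla_antiderivative T a b f G -> G a <= G b.
Proof.
move=> cT Ta Tb ab f0 /nabla_antiderivative_opp dF.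
have : - G (- - b) <= - G (- - a).
  apply: delta_antiderivative_le dF.
  - exact: ts_opp_closed.
  - by rewrite /ts_opp /= opprK.
  - by rewrite /ts_opp /= opprK.
  - by rewrite ltrN2.
  by move=> t Kt; apply: f0; apply/ts_itv_opp; rewrite opprK.
by rewrite !opprK lerN2.
Qed.

Lemma nabla_antiderivativeZD (R : realType) (T : set R) (a b k : R)
    (f g F G : R -> R) :
  nabla_antiderivative T a b f F -> nabla_antiderivative T a b g G ->
  nabla_antiderivative T a b (fun t => k * f t + g t) (fun t => k * F t + G t).
Proof.
move=> /nabla_antiderivative_opp dF /nabla_antiderivative_opp dG.
apply/nabla_antiderivative_opp.
rewrite (_ : (fun t => - (_ + _)) = (fun t => k * - F (- t) + - G (- t))).
  exact: delta_antiderivativeZD.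
by apply/funext => t; rewrite mulrN opprD.
Qed.

(** * Positivity of the integrals on linear combinations *)

(** By existence, [xget] returns true antiderivatives. Their combination is an antiderivative of the
    combined integrand, so positivity applies to it directly. Three terms suffice for a quadratic
    polynomial in one parameter. *)
Lemma delta_integral_lincomb_ge0 (R : realType) (T : set R) (a b x y : R)
    (f g h : R -> R) : closed T -> T a -> T b -> a < b ->
  {within ts_itv T a b, continuous f} ->
  {within ts_itv T a b, continuous g} ->
  {within ts_itv T a b, continuous h} ->
  (forall t, 0 <= x * f t + (y * g t + h t)) ->
  0 <= x * delta_integral T a b f +
       (y * delta_integral T a b g + delta_integral T a b h).
Proof.
move=> cT Ta Tb ab cf cg ch pos; rewrite /delta_integral.
set F := xget _ _; set G := xget _ _; set H := xget _ _.
have dF : delta_antiderivative T a b f F.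
  by apply: xgetPex; exact: delta_antiderivative_exists.
have dG : delta_antiderivative T a b g G.
  by apply: xgetPex; exact: delta_antiderivative_exists.
have dH : delta_antiderivative T a b h H.
  by apply: xgetPex; exact: delta_antiderivative_exists.
have := delta_antiderivative_le cT Ta Tb ab (fun t _ => pos t)
  (delta_antiderivativeZD x dF (delta_antiderivativeZD y dG dH)).
by rewrite /=; lra.
Qed.

Lemma nabla_integral_lincomb_ge0 (R : realType) (T : set R) (a b x y : R)
    (f g h : R -> R) : closed T -> T a -> T b -> a < b ->
  {within ts_itv T a b, continuous f} ->
  {within ts_itv T a b, continuous g} ->
  {within ts_itv T a b, continuous h} ->
  (forall t, 0 <= x * f t + (y * g t + h t)) ->
  0 <= x * nabla_integral T a b f +
       (y * nabla_integral T a b g + nabla_integral T a b h).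
Proof.
move=> cT Ta Tb ab cf cg ch pos; rewrite /nabla_integral.
set F := xget _ _; set G := xget _ _; set H := xget _ _.
have dF : nabla_antiderivative T a b f F.
  by apply: xgetPex; exact: nabla_antiderivative_exists.
have dG : nabla_antiderivative T a b g G.
  by apply: xgetPex; exact: nabla_antiderivative_exists.
have dH : nabla_antiderivative T a b h H.
  by apply: xgetPex; exact: nabla_antiderivative_exists.
have := nabla_antiderivative_le cT Ta Tb ab (fun t _ => pos t)
  (nabla_antiderivativeZD x dF (nabla_antiderivativeZD y dG dH)).
by rewrite /=; lra.
Qed.

Lemma diamond_integral_lincomb_ge0 (R : realType) (T : set R)
    (alpha a b x y : R) (f g h : R -> R) :
  0 <= alpha <= 1 -> closed T -> T a -> T b -> a < b ->
  {within ts_itv T a b, continuous f} ->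
  {within ts_itv T a b, continuous g} ->
  {within ts_itv T a b, continuous h} ->
  (forall t, 0 <= x * f t + (y * g t + h t)) ->
  0 <= x * diamond_integral T alpha a b f +
       (y * diamond_integral T alpha a b g + diamond_integral T alpha a b h).
Proof.
move=> /andP[alpha0 alpha1] cT Ta Tb ab cf cg ch pos; rewrite /diamond_integral.
have D := delta_integral_lincomb_ge0 cT Ta Tb ab cf cg ch pos.
have N := nabla_integral_lincomb_ge0 cT Ta Tb ab cf cg ch pos.
have alpha1' : 0 <= 1 - alpha by rewrite subr_ge0.
have := addr_ge0 (mulr_ge0 alpha0 D) (mulr_ge0 alpha1' N).
by congr (0 <= _); ring.
Qed.

(** * Discriminant argument and the inequality *)

Lemma le_sqrtM_of_quadratic_ge0 (R : realType) (A B C : R) : 0 <= A ->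
  (forall x, 0 <= x ^+ 2 * A + (- (x *+ 2) * B + C)) -> B <= Num.sqrt (A * C).
Proof.
rewrite le_eqVlt => /predU1P[<- pos|A0 pos].
  rewrite mul0r sqrtr0 leNgt; apply/negP => B0.
  (* With [A = 0] and [B > 0] the polynomial is affine, and this point gives it the value -1. *)
  have := pos ((C + 1) / (B *+ 2)).
  have -> : - ((C + 1) / (B *+ 2) *+ 2) * B = - (C + 1) by field; rewrite gt_eqF.
  by lra.
(* [B / A] is the minimiser of the quadratic. *)
have := pos (B / A).
have -> : (B / A) ^+ 2 * A + (- (B / A *+ 2) * B + C) = (A * C - B ^+ 2) / A.
  by field; rewrite gt_eqF.
rewrite pmulr_lge0 ?invr_gt0// subr_ge0 => /ler_wsqrtr; rewrite sqrtr_sqr.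
exact: le_trans (ler_norm B).
Qed.

Theorem mainTheorem2 (R : realType) (T : set R) (hT : time_scale T)
    (a b : R) (ha : T a) (hb : T b) (hab : a < b)
    (alpha : R) (halpha0 : 0 <= alpha) (halpha1 : alpha <= 1)
    (f g : R -> R)
    (hf : {within ts_itv T a b, continuous f})
    (hg : {within ts_itv T a b, continuous g}) :
  diamond_integral T alpha a b (fun t => `|f t * g t|) <=
  Num.sqrt (diamond_integral T alpha a b (fun t => `|f t| ^+ 2) *
            diamond_integral T alpha a b (fun t => `|g t| ^+ 2)).
Proof.
have [_ cT] := hT.
have alpha01 : 0 <= alpha <= 1 by rewrite halpha0.
have cM (u v : R -> R) : {within ts_itv T a b, continuous u} ->
    {within ts_itv T a b, continuous v} ->
    {within ts_itv T a b, continuous (fun t => `|u t * v t|)}.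
  move=> /subspace_continuousP cu /subspace_continuousP cv.
  apply/subspace_continuousP => t Kt; apply: cvg_norm.
  by apply: cvgM; [exact: cu|exact: cv].
have c2 (u : R -> R) : {within ts_itv T a b, continuous u} ->
    {within ts_itv T a b, continuous (fun t => `|u t| ^+ 2)}.
  by move=> cu; under eq_fun do rewrite expr2 -normrM; exact: cM.
have pos := diamond_integral_lincomb_ge0 alpha01 cT ha hb hab.
apply: le_sqrtM_of_quadratic_ge0 => [|x].
  (* Zero coefficients leave only the third integral, which gives the nonnegativity of the leading
     coefficient. *)
  have := pos 0 0 _ _ _ (c2 f hf) (c2 f hf) (c2 f hf).
  by rewrite !mul0r !add0r; apply => t; rewrite !mul0r !add0r sqr_ge0.
apply: pos; [exact: c2|exact: cM|exact: c2|move=> t].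
have -> : x ^+ 2 * `|f t| ^+ 2 + (- (x *+ 2) * `|f t * g t| + `|g t| ^+ 2) =
  (x * `|f t| - `|g t|) ^+ 2 by rewrite normrM; ring.
exact: sqr_ge0.
Qed.
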